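(* Let $(M,\xi)$ be a contact manifold, $\eta$ a (local) contact form for $\xi$, $X$ a contact vector field, $H=-\eta(X)$ its Hamiltonian, and let $x_0$ be an equilibrium point of $X$ with principal coefficient $\tau=-\mathcal{R}(H)(x_0)$. The equilibrium point $x_0$ is non-degenerate if (i) $\tau\neq 0$, and (ii) the bilinear form on the contact hyperplane $\xi(x_0)$ given by $$(\mathbf{u},\mathbf{v})\longmapsto \mathrm{D}_{\mathbf{u}}\left(\mathrm{d}H+\tau\eta\right)(\mathbf{v})$$ is non-degenerate.
   Context: All objects are smooth. A contact manifold $(M,\xi)$ is a manifold $M$ of dimension $2n+1$ with a rank-$2n$ subbundle $\xi\subset TM$ such that, for any (local) 1-form $\eta$ with $\ker\eta=\xi$ (a contact form for $\xi$), $\eta\wedge(\mathrm{d}\eta)^n$ is nowhere zero. The Reeb vector field $\mathcal{R}$ of $\eta$ is determined by $\iota_{\mathcal{R}}\eta=1$, $\iota_{\mathcal{R}}\mathrm{d}\eta=0$. A contact vector field is one whose flow preserves $\xi$; its Hamiltonian with respect to $\eta$ is $H=-\eta(X)$, and then $\iota_X\mathrm{d}\eta=\mathrm{d}H-\mathcal{R}(H)\eta$. At an equilibrium $x_0$ (a zero of $X$) one has $H(x_0)=0$ and $\mathrm{d}H_{x_0}=-\tau\eta_{x_0}$ with $\tau=-\mathcal{R}(H)(x_0)$, called the principal coefficient. An equilibrium is non-degenerate if the linear part of the vector field there has no zero eigenvalue. $\mathrm{D}$ denotes the ordinary derivative (not the exterior derivative): $\tau$ is held constant, and since the 1-form $\mathrm{d}H+\tau\eta$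 vanishes at $x_0$, its derivative $\mathrm{D}_{\mathbf{u}}(\mathrm{d}H+\tau\eta)\in T^*_{x_0}M$ in the direction $\mathbf{u}\in T_{x_0}M$ is independent of the choice of coordinates. In coordinates with $\eta=\sum a_i\,\mathrm{d}x^i$ it is $\sum_{i,j}\left(\frac{\partial^2H}{\partial x^j\partial x^i}+\tau\frac{\partial a_i}{\partial x^j}\right)u^jv^i$. *)

(* Defs.v *)
From HB Require Import structures.
From mathcomp Require Import all_boot all_order all_algebra all_fingroup.
From mathcomp Require Import all_classical all_reals all_analysis.

Set Implicit Arguments.
Unset Strict Implicit.
Unset Printing Implicit Defensive.

Import Order.TTheory GRing.Theory Num.Theory.
Import numFieldNormedType.Exports.

Local Open Scope classical_set_scope.
Local Open Scope ring_scope.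

(* [Ck k A f]: all iterated directional derivatives of [f] of order [<= k]
   exist and are continuous on [A].  Meant for finite-dimensional [V] and open
   [A], since the derivatives at a point of [A] only see [f] near that point. *)
Fixpoint Ck (R : realType) (V W : normedModType R) (k : nat) (A : set V)
    (f : V -> W) : Prop :=
  match k with
  | 0%N => forall x, A x -> {for x, continuous f}
  | k'.+1 => (forall x, A x -> differentiable f x) /\
             (forall v : V, Ck k' A (fun x => 'D_v f x))
  end.

Definition smooth_on (R : realType) (V W : normedModType R) (A : set V)
    (f : V -> W) : Prop := forall k, Ck k A f.

(* Charts take values in R^(p+1), i.e. the dimension is [p.+1]. *)
Record chart (R : realType) (p : nat) (M : topologicalType) := Chart {
  cdom : set M;
  cmap :> M -> 'rV[R]_p.+1;
  cinv : 'rV[R]_p.+1 -> M;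
  cdom_open : open cdom;
  cimg_open : open (cmap @` cdom);
  cmapK : forall x, cdom x -> cinv (cmap x) = x;
  cmap_continuous : forall x, cdom x -> {for x, continuous cmap};
  cinv_continuous :
    forall y, (cmap @` cdom) y -> {for y, continuous cinv}
}.

Record smoothManifold (R : realType) (p : nat) := SmoothManifold {
  carrier :> topologicalType;
  atlas : set (chart R p carrier);
  chart_at : carrier -> chart R p carrier;
  carrier_hausdorff : hausdorff_space carrier;
  carrier_second_countable : @second_countable carrier;
  chart_at_atlas : forall x, atlas (chart_at x);
  chart_at_dom : forall x, cdom (chart_at x) x;
  atlas_smooth : forall c d, atlas c -> atlas d ->
    smooth_on (c @` (cdom c `&` cdom d)) (d \o cinv c)
}.

Section Tensors.
Context {R : realType} {p : nat} (M : smoothManifold R p).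
Local Notation E := 'rV[R]_p.+1.

(* The tangent space T_x M is identified with R^(p+1) by means of the chart
   [chart_at x].  Hence a vector field is a map [M -> E], and a 1-form a map
   [M -> E -> R], whose values at [x] are expressed in [chart_at x]; the
   operations below pass to an arbitrary chart before differentiating. *)

(* d(c^-1)_y : R^(p+1) -> T_x M, for x = c^-1(y). *)
Definition from_chart (c : chart R p M) (y : E) : E -> E :=
  let x := cinv c y in 'd (chart_at x \o cinv c) y.

(* dc_x : T_x M -> R^(p+1). *)
Definition to_chart (c : chart R p M) (x : M) : E -> E :=
  'd (c \o cinv (chart_at x)) (chart_at x x).

Definition field_in_chart (c : chart R p M) (X : M -> E) (y : E) : E :=
  to_chart c (cinv c y) (X (cinv c y)).

Definition form_in_chart (c : chart R p M) (al : M -> E -> R) (y v : E) : R :=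
  al (cinv c y) (from_chart c y v).

Definition smooth_field (V : set M) (X : M -> E) : Prop :=
  forall c, atlas c -> smooth_on (c @` (cdom c `&` V)) (field_in_chart c X).

Definition smooth_form (V : set M) (al : M -> E -> R) : Prop :=
  (forall x, V x -> linear (al x : E -> R^o)) /\
  (forall c, atlas c -> forall v,
     smooth_on (c @` (cdom c `&` V)) (fun y => form_in_chart c al y v : R^o)).

Definition dfun (f : M -> R) (x : M) : E -> R :=
  'd (f \o cinv (chart_at x) : E -> R^o) (chart_at x x).

Definition tangent_map (f : M -> M) (x : M) : E -> E :=
  'd (chart_at (f x) \o f \o cinv (chart_at x)) (chart_at x x).

(* The coordinate derivative (D_u al)(v) = sum_ij (d al_i / d x^j) u^j v^i at
   [x], in the chart [chart_at x].  It depends on the chart unless [al]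
   vanishes at [x]. *)
Definition Dform (al : M -> E -> R) (x : M) (u v : E) : R :=
  'D_u (fun y => form_in_chart (chart_at x) al y v : R^o) (chart_at x x).

Definition ext_deriv (al : M -> E -> R) (x : M) (u v : E) : R :=
  Dform al x u v - Dform al x v u.

Definition smooth_subbundle (k : nat) (xi : M -> {vspace E}) : Prop :=
  (forall x, \dim (xi x) = k) /\
  (forall x0, exists (V : set M) (e : 'I_k -> M -> E),
     [/\ open V, V x0, forall i, smooth_field V (e i) &
         forall x, V x -> xi x = <<[seq e i x | i <- enum 'I_k]>>%VS]).

(* [ph] is a smooth local flow of [X], on the times [-eps < t < eps] and the
   initial points in [U]. *)
Definition local_flow (X : M -> E) (eps : R) (U : set M) (ph : R -> M -> M)
    : Prop :=
  [/\ forall x, U x -> ph 0 x = x,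
      forall (t : R) (x : M), `|t| < eps -> U x ->
        {for (t, x), continuous (fun tx : R * M => ph tx.1 tx.2)},
      forall c d, atlas c -> atlas d ->
        smooth_on [set ty : R^o * E | [/\ `|ty.1| < eps,
                     (c @` (cdom c `&` U)) ty.2 &
                     cdom d (ph ty.1 (cinv c ty.2))]]
                  (fun ty => d (ph ty.1 (cinv c ty.2))) &
      forall (t : R) (x : M), `|t| < eps -> U x ->
        is_derive (t : R^o) (1 : R^o)
          (fun s : R^o => chart_at (ph t x) (ph s x)) (X (ph t x))].

End Tensors.

Section Exterior.
Context {R : realType} {E : Type}.

Definition wedge (k l : nat) (a : ('I_k -> E) -> R) (b : ('I_l -> E) -> R)
    (w : 'I_(k + l) -> E) : R :=
  ((k`! * l`!)%:R)^-1 *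
  \sum_(s : 'S_(k + l)) (-1) ^+ s *
    a (fun i => w (s (lshift l i))) * b (fun j => w (s (rshift k j))).

Fixpoint wedge_pow (b : ('I_2 -> E) -> R) (n : nat) : ('I_(n * 2) -> E) -> R :=
  match n with
  | 0%N => fun _ => 1
  | n'.+1 => wedge b (@wedge_pow b n')
  end.

End Exterior.

Section Contact.
Context {R : realType} {n : nat} (M : smoothManifold R (n * 2)).
Local Notation E := 'rV[R]_(n * 2).+1.

Definition contact_volume (eta : M -> E -> R) (x : M) :
    ('I_(1 + n * 2) -> E) -> R :=
  wedge (fun w : 'I_1 -> E => eta x (w ord0))
        (wedge_pow (fun w : 'I_2 -> E =>
                      ext_deriv eta x (w ord0) (w ord_max)) (n := n)).

Definition contact_form (xi : M -> {vspace E}) (V : set M)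
    (eta : M -> E -> R) : Prop :=
  smooth_form V eta /\ forall x, V x -> forall v, v \in xi x <-> eta x v = 0.

Definition contact_structure (xi : M -> {vspace E}) : Prop :=
  smooth_subbundle (n * 2) xi /\
  forall (V : set M) (eta : M -> E -> R), open V -> contact_form xi V eta ->
    forall x, V x -> exists w, contact_volume eta x w != 0.

Definition reeb_field (V : set M) (eta : M -> E -> R) (Reeb : M -> E) : Prop :=
  smooth_field V Reeb /\
  forall x, V x -> eta x (Reeb x) = 1 /\
                   forall v, ext_deriv eta x (Reeb x) v = 0.

(* The flow of a smooth vector field exists locally, with smooth dependence on
   the initial point, and is unique; so it does not matter that the local flows
   are quantified existentially. *)
Definition contact_field (xi : M -> {vspace E}) (X : M -> E) : Prop :=
  smooth_field setT X /\
  forall x0 : M, exists (eps : R) (U : set M) (ph : R -> M -> M),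
    [/\ 0 < eps, open U, U x0, local_flow X eps U ph &
        forall (t : R) (x : M), `|t| < eps -> U x ->
          [set tangent_map (ph t) x v | v in [set` xi x]] =
          [set` xi (ph t x)]].

Definition hamiltonian (eta : M -> E -> R) (X : M -> E) (x : M) : R :=
  - eta x (X x).

Definition principal_coefficient (H : M -> R) (Reeb : M -> E) (x0 : M) : R :=
  - dfun H x0 (Reeb x0).

Definition equilibrium (X : M -> E) (x0 : M) : Prop := X x0 = 0.

(* The matrix, acting on row vectors, of the linear part of [X] at [x0]. *)
Definition linear_part (X : M -> E) (x0 : M) : 'M[R]_((n * 2).+1) :=
  jacobian (field_in_chart (chart_at x0) X) (chart_at x0 x0).

Definition nondegenerate_equilibrium (X : M -> E) (x0 : M) : Prop :=
  ~~ eigenvalue (linear_part X x0) 0.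

(* In finite dimension it is enough to ask that the left radical be trivial. *)
Definition nondegenerate_form_on (S : {vspace E}) (B : E -> E -> R) : Prop :=
  forall u, u \in S -> (forall v, v \in S -> B u v = 0) -> u = 0.

End Contact.

(* Main.v *)
(* Let eta also denote the form in a chart around x0.  The flow of X preserves
   ker eta, so the Lie derivative of eta along X, whose value on a vector v is
   F_y(v) = (D_X eta)_y(v) + eta_y(D_v X) in coordinates, vanishes on ker eta_y;
   this uses the symmetry of the mixed second derivatives of the flow.  Hence
   F_y(v) eta_y(r) = eta_y(v) F_y(r) for all y, v and r.
   Suppose now that D_u X = 0 at x0, where X = 0, and let r be the Reeb vector at
   x0, so that F(r) = tau there.  For v = u the identity reads 0 = tau eta(u), so
   that u lies in xi(x0).  For v in xi(x0), differentiating it in the direction u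
   gives D_u(eta(D_v X)) = tau (D_u eta)(v), and the left-hand side is
   - D_u(dH)(v) because H = - eta(X).  So u is in the radical of the form in (ii). *)

Require Import Defs.
From HB Require Import structures.
From mathcomp Require Import all_boot all_order all_algebra all_fingroup.
From mathcomp Require Import all_classical all_reals all_analysis.
From mathcomp Require Import ring.

Set Implicit Arguments.
Unset Strict Implicit.
Unset Printing Implicit Defensive.

Import Order.TTheory GRing.Theory Num.Theory.
Import numFieldNormedType.Exports.
Local Open Scope classical_set_scope.
Local Open Scope ring_scope.

(** * Mean value theorem along lines and symmetry of mixed second derivatives *)

(** The first-order expansion of [f] at [x] involves only values near [x], so it is also one of [g];
    by uniqueness of the differential it is the expansion that differentiability of [g] requires. *)
Lemma near_eq_differentiable (R : realType) (U W : normedModType R)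
    (f g : U -> W) (x : U) :
  (\near x, f x = g x) -> differentiable f x -> differentiable g x.
Proof.
move=> fg /[dup] df /diff_locallyP [dfc fE].
have gfx : f x = g x := nbhs_singleton fg.
have gE : g \o shift x = cst (g x) + 'd f x +o_ (0 : U) id.
  apply/eqaddoP => e e0; have /eqaddoP /(_ e e0) := fE.
  have fg0 : \forall y \near (0 : U), f (y + x) = g (y + x).
    by move: fg; rewrite (near_shift 0 x); apply: filterS => y; rewrite /= subr0.
  apply: filterS2 fg0 => y /= fgy.
  by rewrite !fctE /= gfx fgy.
have dE := diff_unique dfc gE.
by apply/diff_locallyP; rewrite dE.
Qed.

Lemma is_derive_line (R : realType) (U W : normedModType R) (f : U -> W)
    (b u : U) (r : R) : differentiable f (r *: u + b) ->
  is_derive r (1 : R) (fun t : R => f (t *: u + b)) ('D_u f (r *: u + b)).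
Proof.
move=> df.
have [dl dlE] : is_diff r (fun t : R => t *: u + b) ( *:%R^~ u).
  by apply: is_diff_eq; rewrite addr0.
have dfl : differentiable (f \o (fun t : R => t *: u + b)) r.
  exact: differentiable_comp.
apply: DeriveDef; first exact: diff_derivable.
by rewrite (deriveE _ dfl) deriveE // diff_comp // /= dlE scale1r.
Qed.

Lemma MVT_line (R : realType) (U : normedModType R) (f : U -> R) (b u : U)
    (s : R) : 0 < s ->
  (forall r, 0 <= r <= s -> differentiable f (r *: u + b)) ->
  exists2 c, 0 <= c <= s & f (s *: u + b) - f b = s * 'D_u f (c *: u + b).
Proof.
move=> s0 df.
have [] := @MVT R (fun t => f (t *: u + b)) (fun t => 'D_u f (t *: u + b)) 0 s s0.
- move=> r; rewrite in_itv /= => /andP[r0 rs].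
  by apply: is_derive_line; apply: df; rewrite !ltW.
- apply: derivable_within_continuous => r; rewrite in_itv /= => rs.
  by have [] := is_derive_line (df r rs).
move=> c; rewrite in_itv /= => /andP[c0 cs]; rewrite scale0r add0r subr0 => ->.
by exists c; rewrite ?ltW // mulrC.
Qed.

Lemma derive_shiftr (R : realType) (U W : normedModType R) (f : U -> W)
    (b u y : U) : 'D_u (fun z => f (b + z)) y = 'D_u f (b + y).
Proof. by rewrite /derive /=; under eq_fun do rewrite addrCA. Qed.

Lemma differentiable_shiftr (R : realType) (U W : normedModType R)
    (f : U -> W) (b y : U) : differentiable f (b + y) ->
  differentiable (fun z => f (b + z)) y.
Proof. by move=> df; apply: (@differentiable_comp _ _ _ _ (fun z => b + z) f). Qed.

(** The mean value theorem, applied along [u] to the increment of [f] under the shift by [s *: v]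
    and then along [v] to ['D_u f], turns the second difference into [s ^+ 2] times the mixed
    derivative at a point of a small parallelogram at [a]. Continuity of that derivative
    concludes. *)
Lemma second_difference_cvg (R : realType) (U : normedModType R) (f : U -> R)
    (a u v : U) :
  (\near a, differentiable f a) -> (\near a, differentiable ('D_u f) a) ->
  {for a, continuous ('D_v ('D_u f))} ->
  (s ^- 2 * (f (s *: v + (s *: u + a)) - f (s *: u + a) - (f (s *: v + a) - f a)))
    @[s --> 0^'+] --> 'D_v ('D_u f) a.
Proof.
move=> df d2f cf; apply/cvgrPdist_lt => e e0.
move/cvgrPdist_lt: cf => /(_ e e0) cf.
have /nbhs_normP [d /= d0 ball_d] : \forall y \near a, [/\ differentiable f y,
    differentiable ('D_u f) y & `|'D_v ('D_u f) a - 'D_v ('D_u f) y| < e].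
  by near=> y; split; near: y.
(* For [s] below this bound the parallelogram stays in the ball of radius [d]; the summand 1 keeps
   the denominator positive when [u] and [v] both vanish. *)
have dd : 0 < d / (`|u| + `|v| + 1).
  by rewrite divr_gt0 // ltr_wpDl // addr_ge0.
near=> s.
have s0 : 0 < s by [].
have inb r t : 0 <= r <= s -> 0 <= t <= s -> `|a - (t *: v + (r *: u + a))| < d.
  move=> /andP[r0 rs] /andP[t0 ts]; rewrite addrA opprD addrCA subrr addr0 normrN.
  apply: (@le_lt_trans _ _ (s * (`|u| + `|v|))).
    apply: (le_trans (ler_normD _ _)); rewrite !normrZ (ger0_norm r0) (ger0_norm t0).
    by rewrite mulrDr addrC lerD // ler_wpM2r.
  have ssd : s < d / (`|u| + `|v| + 1) by near: s; apply: nbhs_right_lt.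
  apply: (@le_lt_trans _ _ (s * (`|u| + `|v| + 1))).
    by rewrite ler_wpM2l ?ltW // ltrDl.
  by rewrite -ltr_pdivlMr // ltr_wpDl // addr_ge0.
have s_ss : 0 <= s <= s by rewrite ltW //=.
have z_ss : 0 <= (0 : R) <= s by rewrite lexx /= ltW.
pose h y := f (s *: v + y) - f y.
have dh r : 0 <= r <= s -> differentiable h (r *: u + a).
  move=> rs; apply: differentiableB.
    by apply: differentiable_shiftr; have [] := ball_d _ (inb r s rs s_ss).
  by have [] := ball_d _ (inb r 0 rs z_ss); rewrite scale0r add0r.
have [c cs hc] := MVT_line s0 dh.
have [] := @MVT_line _ _ ('D_u f) (c *: u + a) v s s0.
  by move=> t ts; have [] := ball_d _ (inb c t cs ts).
move=> c' cs' hc'.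
rewrite -/(h (s *: u + a)) -/(h a) hc.
have -> : 'D_u h (c *: u + a) = s * 'D_v ('D_u f) (c' *: v + (c *: u + a)).
  rewrite -hc' deriveB ?derive_shiftr //; apply: diff_derivable.
    by apply: differentiable_shiftr; have [] := ball_d _ (inb c s cs s_ss).
  by have [] := ball_d _ (inb c 0 cs z_ss); rewrite scale0r add0r.
rewrite mulrA -expr2 mulKf ?expf_neq0 ?gt_eqF //.
by have [] := ball_d _ (inb c c' cs cs').
Unshelve. all: by end_near. Qed.

(** The second difference is symmetric in [u] and [v], and both mixed derivatives are its limit. *)
Lemma derive_schwarz (R : realType) (U : normedModType R) (f : U -> R)
    (a u v : U) :
  (\near a, differentiable f a) ->
  (\near a, differentiable ('D_u f) a) -> (\near a, differentiable ('D_v f) a) ->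
  {for a, continuous ('D_v ('D_u f))} -> {for a, continuous ('D_u ('D_v f))} ->
  'D_v ('D_u f) a = 'D_u ('D_v f) a.
Proof.
move=> df duf dvf cuv cvu.
have huv := second_difference_cvg df duf cuv.
have := second_difference_cvg df dvf cvu.
have -> : (fun s => s ^- 2 *
    (f (s *: u + (s *: v + a)) - f (s *: v + a) - (f (s *: u + a) - f a))) =
  (fun s => s ^- 2 *
    (f (s *: v + (s *: u + a)) - f (s *: u + a) - (f (s *: v + a) - f a))).
  by apply/funext => s; rewrite addrCA; congr (_ * _); ring.
by move/cvg_lim => <- //; move/cvg_lim : huv => <-.
Qed.

(** * Leibniz rule for a field of linear forms paired with a vector field *)

(** Near [z] the pairing is a finite sum of coordinates of [g] times values of [f] on the standard
    basis, to which the product rule applies. *)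
Lemma derive_pairing (R : realType) (m : nat) (U : normedModType R)
    (f : U -> 'rV[R]_m -> R) (g : U -> 'rV[R]_m) (z : U) :
  (\forall y \near z, linear (f y : 'rV[R]_m -> R^o)) ->
  (forall w, differentiable (fun y => f y w) z) -> differentiable g z ->
  differentiable (fun y => f y (g y)) z /\
  forall u, 'D_u (fun y => f y (g y)) z =
    'D_u (fun y => f y (g z)) z + f z ('D_u g z).
Proof.
move=> flin fd gd.
pose e j : 'rV[R]_m := delta_mx 0 j.
have fE (y : U) : linear (f y : 'rV[R]_m -> R^o) ->
    forall w, f y w = \sum_j w 0 j * f y (e j).
  move=> fy w.
  pose L := GRing.isLinear.Build _ _ _ _ _ fy.
  pose F : {linear 'rV[R]_m -> R^o} := HB.pack (f y : 'rV[R]_m -> R^o) L.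
  rewrite [in LHS](row_sum_delta w) -[LHS]/(F _) linear_sum.
  by apply: eq_bigr => j _; rewrite linearZ.
(* [h] stays arbitrary because the formula is used twice, for [g] and for the constant [g z]; the
   latter isolates the derivative of [f]. *)
pose G (h : U -> 'rV[R]_m) := \sum_j (fun y => h y 0 j * f y (e j)).
have GE h : \forall y \near z, G h y = f y (h y).
  by apply: filterS flin => y /fE ->; rewrite /G fct_sumE.
have gjd j : differentiable (fun y => g y 0 j) z.
  exact: (differentiable_comp gd (differentiable_coord _ _ _)).
have Gd (h : U -> 'rV[R]_m) : (forall j, differentiable (fun y => h y 0 j) z) -> differentiable (G h) z.
  by move=> hd; apply: differentiable_sum => j; apply: differentiableM.
split; first exact: near_eq_differentiable (GE g) (Gd g gjd).
have DG (h : U -> 'rV[R]_m) (u : U) : (forall j, differentiable (fun y => h y 0 j) z) -> 'D_u (G h) z =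
    \sum_j (h z 0 j * 'D_u (fun y => f y (e j)) z + f z (e j) * 'D_u (fun y => h y 0 j) z).
  move=> hd; rewrite derive_sum; last by move=> j; apply: diff_derivable; apply: differentiableM.
  by apply: eq_bigr => j _; rewrite deriveM //; apply: diff_derivable.
move=> u; rewrite -(near_eq_derive _ (GE g)) -(near_eq_derive _ (GE (fun=> g z))).
rewrite !DG // big_split /=; congr (_ + _).
  by apply: eq_bigr => j _; rewrite derive_cst mulr0 addr0.
rewrite (fE z (nbhs_singleton flin)) derive_mx; last exact: diff_derivable.
by apply: eq_bigr => j _; rewrite mxE mulrC.
Qed.

Lemma derive_linear (R : realType) (U W : normedModType R) (f : U -> W) (y : U) :
  differentiable f y -> linear (fun u => 'D_u f y).
Proof. by move=> fd k u v /=; rewrite !deriveE // linearP. Qed.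

Lemma linear_fun0 (R : pzRingType) (V W : lmodType R) (f : V -> W) :
  linear f -> f 0 = 0.
Proof. by move=> /(_ (-1) 0 0); rewrite scaler0 addr0 scaleN1r addNr. Qed.

Lemma linear_funB (R : pzRingType) (V W : lmodType R) (f : V -> W) k l u v :
  linear f -> f (k *: u - l *: v) = k *: f u - l *: f v.
Proof.
move=> fl; have := fl k u 0; rewrite (linear_fun0 fl) !addr0 => fk.
by rewrite [X in f X]addrC -[in LHS]scaleNr fl fk scaleNr addrC.
Qed.

Lemma derive_pairing_zero (R : realType) (m : nat) (U : normedModType R)
    (f : U -> 'rV[R]_m -> R) (g : U -> 'rV[R]_m) (z u : U) :
  (\forall y \near z, linear (f y : 'rV[R]_m -> R^o)) ->
  (forall w, differentiable (fun y => f y w) z) -> differentiable g z ->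
  g z = 0 -> 'D_u (fun y => f y (g y)) z = f z ('D_u g z).
Proof.
move=> flin fd gd gz; have [_ ->] := derive_pairing flin fd gd.
rewrite gz -[RHS]add0r; congr (_ + _).
rewrite -(derive_cst (0 : R) z u); apply: near_eq_derive.
by apply: filterS flin => y; exact: linear_fun0.
Qed.

Lemma smooth_on_differentiable (R : realType) (V W : normedModType R)
    (A : set V) (f : V -> W) (x : V) :
  smooth_on A f -> A x -> differentiable f x.
Proof. by move=> /(_ 1%N) [] fd _; exact: fd. Qed.

Lemma smooth_on_derive (R : realType) (V W : normedModType R)
    (A : set V) (f : V -> W) (v : V) :
  smooth_on A f -> smooth_on A ('D_v f).
Proof. by move=> fs k; have [_] := fs k.+1; apply. Qed.

(** * The argument in a single chart *)

Section LinearizedContactCondition.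
Context {R : realType} {m : nat}.
Local Notation E := 'rV[R]_m.
Variables (O : set E) (a : E -> E -> R) (Y : E -> E).
Hypothesis O_open : open O.
Hypothesis a_linear : forall y, O y -> linear (a y : E -> R^o).
Hypothesis a_smooth : forall v, smooth_on O (fun y => a y v : R^o).
Hypothesis Y_smooth : smooth_on O Y.

Let near_O y : O y -> \forall z \near y, O z.
Proof. by move=> Oy; exact: (open_nbhs_nbhs (conj O_open Oy)). Qed.

Let derive_form_linear (v y : E) : O y ->
  linear ((fun w => 'D_v (fun z => a z w) y) : E -> R^o).
Proof.
move=> Oy k w w' /=.
have -> : 'D_v (fun z => a z (k *: w + w')) y =
    'D_v (k \*: (fun z => a z w : R^o) + (fun z => a z w' : R^o)) y.
  apply: near_eq_derive; apply: filterS (near_O Oy) => z Oz.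
  exact: a_linear.
have ad u : derivable (fun z => a z u : R^o) y v.
  by apply: diff_derivable; exact: smooth_on_differentiable (a_smooth u) Oy.
by rewrite deriveD ?deriveZ //; exact: derivableZ.
Qed.

(* The value on [v] of the Lie derivative of the form [a] along [Y]. *)
Let lie y v := 'D_(Y y) (fun z => a z v) y + a y ('D_v Y y).

Let ham y := - a y (Y y).

Let derive_ham v y : O y ->
  'D_v ham y = - ('D_v (fun z => a z (Y y)) y + a y ('D_v Y y)).
Proof.
move=> Oy.
have [|||dd dE] := @derive_pairing R m E a Y y.
- by apply: filterS (near_O Oy).
- by move=> w; apply: smooth_on_differentiable (a_smooth w) Oy.
- exact: smooth_on_differentiable Y_smooth Oy.
by rewrite deriveN ?dE //; apply: diff_derivable.
Qed.

Hypothesis lie_ker : forall y v, O y -> a y v = 0 -> lie y v = 0.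

(** The combination [a y w *: v - a y v *: w] lies in the kernel of [a y], where [lie y] vanishes by
    [lie_ker]; linearity of [lie y] turns this into the identity. *)
Let lie_cross y v w : O y -> lie y v * a y w = a y v * lie y w.
Proof.
move=> Oy; apply/eqP; rewrite -subr_eq0; apply/eqP.
have aL := a_linear Oy.
have Yd := smooth_on_differentiable Y_smooth Oy.
have liel : linear (lie y : E -> R^o).
  move=> k u u'; rewrite /lie derive_form_linear // derive_linear // aL.
  by rewrite scalerDr addrACA.
have lC (f : E -> R) : linear (f : E -> R^o) ->
    f (a y w *: v - a y v *: w) = a y w * f v - a y v * f w.
  exact: linear_funB.
have /(lie_ker Oy) : a y (a y w *: v - a y v *: w) = 0.
  by rewrite lC // mulrC subrr.
by rewrite lC // mulrC.
Qed.

(** This is the theorem read in one chart: [a] is the contact form, [r] the Reeb vector at [y0], and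
    the contact property of the field enters through [lie_ker]. *)
Lemma linearized_kernel_trivial (y0 r u : E) : O y0 -> Y y0 = 0 ->
  a y0 r = 1 -> let tau := - 'D_r ham y0 in tau != 0 ->
  (forall u, a y0 u = 0 ->
    (forall v, a y0 v = 0 ->
       'D_u (fun y => 'D_v ham y + tau * a y v) y0 = 0) -> u = 0) ->
  'D_u Y y0 = 0 -> u = 0.
Proof.
move=> Oy0 Y0 ar tau tau0 nondeg Yu.
have Ynear := near_O Oy0.
have Yd := smooth_on_differentiable Y_smooth Oy0.
have aL : \forall y \near y0, linear (a y : E -> R^o) by apply: filterS Ynear.
have ad v := smooth_on_differentiable (a_smooth v) Oy0.
have add v w := smooth_on_differentiable (smooth_on_derive w (a_smooth v)) Oy0.
have Ydd v := smooth_on_differentiable (smooth_on_derive v Y_smooth) Oy0.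
have f0 (f : E -> R) : linear (f : E -> R^o) -> f 0 = 0.
  exact: linear_fun0.
have D0a v : 'D_v (fun y => a y 0) y0 = 0.
  exact: (f0 (fun w => 'D_v (fun z => a z w) y0) (derive_form_linear _ Oy0)).
have DYa v : 'D_(Y y0) (fun y => a y v) y0 = 0 by rewrite Y0 derive0.
(* Because [Y] vanishes at [y0], both sides reduce to [a y0 ('D_r Y y0)]. *)
have tauE : tau = lie y0 r.
  by rewrite /tau derive_ham // opprK /lie DYa Y0 D0a.
have dlin v : \forall y \near y0, linear ((fun w => 'D_w (fun z => a z v) y) : E -> R^o).
  apply: filterS Ynear => y Oy; apply: derive_linear.
  exact: smooth_on_differentiable (a_smooth v) Oy.
have dflin v : \forall y \near y0, linear ((fun w => 'D_v (fun z => a z w) y) : E -> R^o).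
  by apply: filterS Ynear => y Oy; exact: derive_form_linear.
have d1 v := (derive_pairing (dlin v) (add v) Yd).1.
(* The first term of [lie] is linear in [Y y]; since [Y] and ['D_u Y] both vanish at [y0], so does
   its derivative along [u]. *)
have Dd1 v : 'D_u (fun y => 'D_(Y y) (fun z => a z v) y) y0 = 0.
  by rewrite (derive_pairing_zero _ (dlin v) (add v) Yd Y0) Yu derive0.
have d2 v := (derive_pairing aL ad (Ydd v)).1.
have lied v : differentiable (fun y => lie y v) y0.
  exact: differentiableD.
have Dlie v : 'D_u (fun y => lie y v) y0 = 'D_u (fun y => a y ('D_v Y y)) y0.
  by rewrite deriveD ?Dd1 ?add0r //; exact: diff_derivable.
(* This is [lie_cross] with [w = r], differentiated along [u]. At [y0] the factors [a y0 v] and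
   [lie y0 v] vanish, which leaves one term on each side. *)
have key v : a y0 v = 0 -> 'D_u (fun y => lie y v) y0 = tau * 'D_u (fun y => a y v) y0.
  move=> av.
  have : 'D_u ((fun y => lie y v) * (fun y => a y r)) y0 =
         'D_u ((fun y => a y v) * (fun y => lie y r)) y0.
    by apply: near_eq_derive; apply: filterS Ynear => y Oy; exact: lie_cross.
  rewrite !deriveM; do ?exact: diff_derivable.
  by rewrite (lie_ker Oy0 av) av ar !scale0r scale1r !add0r tauE.
(* [lie y0 u] vanishes because [Y y0] and ['D_u Y y0] do, so [lie_cross] reads
   [0 = a y0 u * tau]. *)
have au : a y0 u = 0.
  have /eqP := lie_cross u r Oy0.
  rewrite ar mulr1 -tauE {1}/lie DYa Yu f0 ?add0r; last exact: a_linear.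
  by rewrite eq_sym mulf_eq0 (negPf tau0) orbF => /eqP.
apply: nondeg => // v av.
(* After the Leibniz expansion of the Hamiltonian, the summand linear in [Y y] has zero derivative
   at [y0], and the other two cancel by [key]. *)
have -> : 'D_u (fun y => 'D_v ham y + tau * a y v) y0 =
   'D_u (- ((fun y => 'D_v (fun z => a z (Y y)) y) + (fun y => a y ('D_v Y y))) +
         tau \*: (fun y => a y v : R^o)) y0.
  apply: near_eq_derive; apply: filterS Ynear => y Oy.
  by rewrite derive_ham.
have [d3 _] := derive_pairing (dflin v) (fun w => add w v) Yd.
have j3 := diff_derivable (v := u) d3; have j4 := diff_derivable (v := u) (d2 v).
have ja := diff_derivable (v := u) (ad v).
rewrite (deriveD (derivableN (derivableD j3 j4)) (derivableZ (k := tau) ja)).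
rewrite (deriveN (derivableD j3 j4)) (deriveD j3 j4) (deriveZ _ ja).
rewrite (derive_pairing_zero _ (dflin v) (fun w => add w v) Yd Y0) Yu D0a add0r.
by rewrite -Dlie key // addNr.
Qed.

End LinearizedContactCondition.

(** * Partial derivatives, local chain rule and symmetry for vector-valued maps *)

Lemma near_pair_fst (T T' : topologicalType) (x : T) (y : T') (P : T * T' -> Prop) :
  (\forall q \near (x, y), P q) -> \forall s \near x, P (s, y).
Proof.
by apply: (@cvg_pair _ _ _ (nbhs x) (nbhs x) (nbhs y) _ _ _ id (cst y)) => //;
  exact: cvg_cst.
Qed.

Lemma smooth_on_subset (R : realType) (V W : normedModType R) (A B : set V)
    (f : V -> W) : A `<=` B -> smooth_on B f -> smooth_on A f.
Proof.
move=> AB fs k; move: {fs}(fs k); elim: k f => [|k IH] f /=.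
  by move=> fc x /AB; exact: fc.
by move=> [fd fD]; split=> [x /AB|v]; [exact: fd|exact/IH/fD].
Qed.

Lemma derive_fst (R : realType) (U U' W : normedModType R) (f : U * U' -> W)
    (u x : U) (y : U') : 'D_(u, 0) f (x, y) = 'D_u (fun z => f (z, y)) x.
Proof.
rewrite /derive; apply: (congr1 (fun g => lim (g @ 0^'))); apply/funext => h /=.
by congr (_ *: (f (_, _) - _)); rewrite /= scaler0 add0r.
Qed.

Lemma derive_snd (R : realType) (U U' W : normedModType R) (f : U * U' -> W)
    (v y : U') (x : U) : 'D_(0, v) f (x, y) = 'D_v (fun z => f (x, z)) y.
Proof.
rewrite /derive; apply: (congr1 (fun g => lim (g @ 0^'))); apply/funext => h /=.
by congr (_ *: (f (_, _) - _)); rewrite /= scaler0 add0r.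
Qed.

Lemma differentiable_snd (R : realType) (U U' W : normedModType R)
    (f : U * U' -> W) (x : U) (y : U') : differentiable f (x, y) ->
  differentiable (fun z => f (x, z)) y.
Proof.
move=> fd; apply: (@differentiable_comp _ _ _ _ (fun z => (x, z)) f).
  exact: (@differentiable_pair _ _ _ _ (cst x) id).
exact: fd.
Qed.

(** Composites of charts agree with the intended map only where the charts invert each other, hence
    a chain rule for an [h] that equals the composite near [z]. *)
Lemma near_diff_comp (R : realType) (U V W : normedModType R) (f : U -> V)
    (g : V -> W) (h : U -> W) (z : U) :
  differentiable f z -> differentiable g (f z) ->
  (\forall y \near z, g (f y) = h y) ->
  differentiable h z /\ forall v, 'd h z v = 'd g (f z) ('d f z v).
Proof.
move=> fd gd gfh.
have gfd := differentiable_comp fd gd.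
have hd := near_eq_differentiable gfh gfd; split=> // v.
by rewrite -deriveE // -(near_eq_derive _ gfh) deriveE // diff_comp.
Qed.

Lemma derive_schwarz_rV (R : realType) (U : normedModType R) (m : nat)
    (f : U -> 'rV[R]_m) (A : set U) (a u v : U) :
  nbhs a A -> smooth_on A f -> 'D_v ('D_u f) a = 'D_u ('D_v f) a.
Proof.
move=> nA fs.
have d1 y : A y -> differentiable f y by exact: smooth_on_differentiable.
have d2 w y : A y -> differentiable ('D_w f) y.
  exact/smooth_on_differentiable/smooth_on_derive.
have d3 w w' y : A y -> differentiable ('D_w ('D_w' f)) y.
  exact/smooth_on_differentiable/smooth_on_derive/smooth_on_derive.
have coordd (g : U -> 'rV[R]_m) y i j : differentiable g y ->
    differentiable (fun z => g z i j) y.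
  by move=> gd; exact: (differentiable_comp gd (differentiable_coord _ _ _)).
have coordD (g : U -> 'rV[R]_m) w y i j : differentiable g y ->
    'D_w (fun z => g z i j) y = 'D_w g y i j.
  by move=> gd; rewrite derive_mx ?mxE //; exact: diff_derivable.
have aA := nbhs_singleton nA.
(* [A] need not be open: an equality on [A] can be differentiated only at points of which [A] is a
   neighbourhood, and all points near [a] are such. *)
have nnA : \forall y \near a, nbhs y A := nbhs_interior nA.
have coordDD w w' y i j : nbhs y A ->
    'D_w ('D_w' (fun z => f z i j)) y = 'D_w ('D_w' f) y i j.
  move=> yA; rewrite -coordD; last exact: (d2 _ _ (nbhs_singleton yA)).
  by apply: near_eq_derive; apply: filterS yA => z Az; rewrite coordD //; exact: d1.
have coordDd w i j : \forall y \near a, differentiable ('D_w (fun z => f z i j)) y.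
  apply: filterS nnA => y yA.
  apply: near_eq_differentiable (coordd _ _ i j (d2 w y (nbhs_singleton yA))).
  by apply: filterS yA => z Az; rewrite coordD //; exact: d1.
have coordDDc w w' i j : {for a, continuous ('D_w ('D_w' (fun z => f z i j)))}.
  apply: differentiable_continuous.
  apply: near_eq_differentiable (coordd _ _ i j (d3 w w' a aA)).
  by apply: filterS nnA => z Az; rewrite coordDD.
apply/rowP => j.
apply: (eq_trans (esym (coordDD v u a _ j nA))).
apply: (eq_trans _ (coordDD u v a _ j nA)).
have fd : \forall y \near a, differentiable (fun z => f z 0 j) y.
  by apply: filterS nA => y /d1 /coordd.
exact: (derive_schwarz fd (coordDd u 0 j) (coordDd v 0 j)
  (coordDDc v u 0 j) (coordDDc u v 0 j)).
Qed.

(** * Vectors, forms and functions under change of chart *)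

Section ChartCalculus.
Context {R : realType} {p : nat} (M : smoothManifold R p).
Local Notation E := 'rV[R]_p.+1.
Implicit Types (c d : chart R p M) (x : M).

Lemma cinv_cvg c x : cdom c x -> cinv c @ c x --> x.
Proof.
move=> cx; rewrite -[X in _ --> X](cmapK cx).
by apply: cinv_continuous; exists x.
Qed.

(** This carries local properties into coordinates, together with the fact that [c] and [cinv c] are
    mutually inverse there. *)
Lemma near_chart c x (P : M -> Prop) : cdom c x -> (\forall z \near x, P z) ->
  \forall y \near c x, [/\ P (cinv c y), cdom c (cinv c y) & c (cinv c y) = y].
Proof.
move=> cx xP.
have nim : nbhs (c x) (c @` cdom c).
  by apply: open_nbhs_nbhs; split; [exact: cimg_open | exists x].
have nP : \forall y \near c x, P (cinv c y) by exact: (cinv_cvg cx xP).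
apply: filterS2 nim nP => y [z cz <-] /=; rewrite !cmapK //.
Qed.

Lemma near_cdom c x : cdom c x -> \forall z \near x, cdom c z.
Proof. by move=> cx; apply: open_nbhs_nbhs; split => //; exact: cdom_open. Qed.

Lemma open_chart_image c (A : set M) : open A -> open (c @` (cdom c `&` A)).
Proof.
move=> Ao; rewrite openE => _ [x [cx Ax] <-].
have := near_chart cx (open_nbhs_nbhs (conj Ao Ax)).
by apply: filterS => y [Ay cy <-]; exists (cinv c y).
Qed.

Lemma transition_differentiable c d x : atlas c -> atlas d -> cdom c x ->
  cdom d x -> differentiable (d \o cinv c) (c x).
Proof.
move=> ca da cx dx; apply: smooth_on_differentiable (atlas_smooth ca da) _.
by exists x.
Qed.

(** The two transition maps compose to the identity near [c x], so the chain rule makes their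
    differentials inverse. *)
Lemma transition_diffK c d x (v : E) : atlas c -> atlas d -> cdom c x ->
  cdom d x -> 'd (c \o cinv d) (d x) ('d (d \o cinv c) (c x) v) = v.
Proof.
move=> ca da cx dx.
have cd := transition_differentiable ca da cx dx.
have dc := transition_differentiable da ca dx cx.
have := @near_diff_comp _ _ _ _ (d \o cinv c) (c \o cinv d) id (c x) cd.
rewrite /= cmapK // => -[//||_ <-]; last by rewrite diff_val.
have := near_chart cx (near_cdom dx).
by apply: filterS => y [dy cy cK]; rewrite cmapK.
Qed.

Lemma from_chart_to_chart c x (v : E) : atlas c -> cdom c x ->
  from_chart c (c x) (to_chart c x v) = v.
Proof.
move=> ca cx; rewrite /from_chart /to_chart cmapK //.
by apply: transition_diffK => //; [exact: chart_at_atlas | exact: chart_at_dom].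
Qed.

Lemma from_chart_at x (v : E) : from_chart (chart_at x) (chart_at x x) v = v.
Proof.
have cx := chart_at_dom x; have ca := chart_at_atlas x.
rewrite /from_chart cmapK //.
rewrite -[LHS]deriveE; last exact: transition_differentiable.
rewrite (@near_eq_derive _ _ _ _ id) ?derive_id //.
by apply: filterS (near_chart cx (near_cdom cx)) => y [].
Qed.

Lemma form_in_chart_linear c (al : M -> E -> R) (y : E) :
  linear (al (cinv c y) : E -> R^o) -> linear (form_in_chart c al y : E -> R^o).
Proof. by move=> l k u v; rewrite /form_in_chart /from_chart linearP l. Qed.

(** The transition differentials acting on the form and on the field cancel, so the pairing does not
    depend on the chart. *)
Lemma form_in_chart_field c (al : M -> E -> R) (X : M -> E) x : atlas c ->
  cdom c x -> form_in_chart c al (c x) (field_in_chart c X (c x)) = al x (X x).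
Proof.
by move=> ca cx; rewrite /form_in_chart /field_in_chart !cmapK // from_chart_to_chart.
Qed.

Lemma smooth_form_field_differentiable c (V : set M) (al : M -> E -> R)
    (X : M -> E) x : atlas c -> open V -> cdom c x -> V x ->
  smooth_form V al -> smooth_field V X ->
  differentiable (fun y => al (cinv c y) (X (cinv c y)) : R^o) (c x).
Proof.
move=> ca Vo cx Vx [all als] Xs.
have cVx : (c @` (cdom c `&` V)) (c x) by exists x.
have nV := near_chart cx (open_nbhs_nbhs (conj Vo Vx)).
have [|||fd _] := @derive_pairing R _ _ (form_in_chart c al)
  (field_in_chart c X) (c x).
- by apply: filterS nV => y [Vy cy cK]; apply/form_in_chart_linear/all.
- by move=> w; exact: smooth_on_differentiable (als c ca w) cVx.
- exact: smooth_on_differentiable (Xs c ca) cVx.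
apply: near_eq_differentiable fd; apply: filterS nV => y [Vy cy cK].
by rewrite -[in LHS]cK form_in_chart_field.
Qed.

(** [dfun f] is computed at each point in that point's own chart, and [chart_at] may jump; the chain
    rule gives its expression in a fixed chart. *)
Lemma form_in_chart_dfun c (f : M -> R) x (v : E) : atlas c -> cdom c x ->
  differentiable (f \o cinv (chart_at x) : E -> R^o) (chart_at x x) ->
  form_in_chart c (dfun f) (c x) v = 'D_v (f \o cinv c : E -> R^o) (c x).
Proof.
move=> ca cx fd.
have da := chart_at_atlas x; have dx := chart_at_dom x.
have cd := transition_differentiable ca da cx dx.
rewrite /form_in_chart /dfun /from_chart cmapK //.
have := @near_diff_comp _ _ _ _ _ (f \o cinv (chart_at x) : E -> R^o)
  (f \o cinv c : E -> R^o) _ cd.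
rewrite /= cmapK // => -[//||hd <-]; last by rewrite deriveE.
apply: filterS (near_chart cx (near_cdom dx)) => y [dy cy cK].
by rewrite /= cmapK.
Qed.

End ChartCalculus.

(** * The flow in a chart and the Lie derivative of the contact form *)

Section ContactFlow.
Context {R : realType} {n : nat} (M : smoothManifold R (n * 2)).
Local Notation E := 'rV[R]_(n * 2).+1.
Variables (xi : M -> {vspace E}) (V : set M) (eta : M -> E -> R).
Hypotheses (V_open : open V) (eta_form : contact_form xi V eta).
Variables (X : M -> E) (eps : R) (U : set M) (ph : R -> M -> M).
Hypotheses (eps_gt0 : 0 < eps) (U_open : open U).
Hypothesis ph_flow : local_flow X eps U ph.
Hypothesis ph_xi : forall (t : R) (x : M), `|t| < eps -> U x ->
  [set tangent_map (ph t) x v | v in [set` xi x]] = [set` xi (ph t x)].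
Variables (c : chart R (n * 2) M) (x : M).
Hypotheses (c_atlas : atlas c) (cx : cdom c x) (Ux : U x) (Vx : V x).

(** Time and position form one variable, so that time and space derivatives are directional
    derivatives of a single map and can be exchanged. *)
Let psi (ty : R^o * E) : E := c (ph ty.1 (cinv c ty.2)).

Let near_flow t z (P : M -> Prop) : `|t| < eps -> U z ->
  (\forall w \near ph t z, P w) -> \forall tz \near (t, z), P (ph tz.1 tz.2).
Proof. by have [_ phc _ _] := ph_flow => te Uz; exact: (phc t z te Uz). Qed.

Let near_flow_time t z (P : M -> Prop) : `|t| < eps -> U z ->
  (\forall w \near ph t z, P w) -> \forall s \near t, P (ph s z).
Proof.
by move=> te Uz /(near_flow te Uz) /near_pair_fst.
Qed.

Let near_flow_space t (P : M -> Prop) : `|t| < eps ->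
  (\forall w \near ph t x, P w) -> \forall y \near c x, P (ph t (cinv c y)).
Proof.
move=> te /(near_flow te Ux).
have : (fun y => (t, cinv c y)) @ c x --> (t, x).
  by apply: (@cvg_pair _ _ _ (nbhs (c x)) (nbhs t) (nbhs x) _ _ _ (cst t) (cinv c));
    [exact: cvg_cst|exact: cinv_cvg].
by move=> h /h.
Qed.

Let flow_domain : set (R^o * E) := [set ty | [/\ `|ty.1| < eps,
  (c @` (cdom c `&` U)) ty.2 & cdom c (ph ty.1 (cinv c ty.2))]].

Let psi_smooth : smooth_on flow_domain psi.
Proof. by have [_ _ phs _] := ph_flow; exact: phs. Qed.

(** The flow at time 0 is the identity, so joint continuity keeps short trajectories starting near
    [x] in the chart domain and in [V]. *)
Let near_flow_domain : \forall ty \near ((0, c x) : R^o * E),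
  flow_domain ty /\ V (ph ty.1 (cinv c ty.2)).
Proof.
have [ph0 _ _ _] := ph_flow.
have ez : `|0 : R| < eps by rewrite normr0.
have phx : \forall ty \near ((0, c x) : R^o * E),
    cdom c (ph ty.1 (cinv c ty.2)) /\ V (ph ty.1 (cinv c ty.2)).
  have : \forall w \near ph 0 x, cdom c w /\ V w.
    rewrite ph0 //; apply: filterI; first exact: near_cdom.
    exact: (open_nbhs_nbhs (conj V_open Vx)).
  move=> /(near_flow ez Ux).
  have : (fun ty : R^o * E => (ty.1 : R, cinv c ty.2)) @ ((0, c x) : R^o * E) -->
      ((0 : R), x).
    apply: (@cvg_pair _ _ _ (nbhs ((0, c x) : R^o * E)) (nbhs (0 : R)) (nbhs x)
      _ _ _ fst (cinv c \o snd)); first exact: cvg_fst.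
    apply: (@cvg_comp _ _ _ snd (cinv c) _ (nbhs (c x)) _ _ (cinv_cvg cx)).
    exact: cvg_snd.
  by move=> h /h.
have nt : \forall ty \near ((0, c x) : R^o * E), `|ty.1| < eps.
  have : fst @ ((0, c x) : R^o * E) --> (0 : R^o) by exact: cvg_fst.
  by move=> h; exact: (h _ (@nbhs0_lt R R^o _ eps_gt0)).
have ny : \forall ty \near ((0, c x) : R^o * E), (c @` (cdom c `&` U)) ty.2.
  have : snd @ ((0, c x) : R^o * E) --> c x by exact: cvg_snd.
  move=> h; apply: (h (c @` (cdom c `&` U))).
  by apply: open_nbhs_nbhs; split; [exact: open_chart_image | exists x].
by apply: filterS3 nt ny phx => ty te tyU [tyc tyV]; split.
Qed.

Let psi0 : \forall z \near c x, psi (0, z) = z.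
Proof.
have [ph0 _ _ _] := ph_flow.
have := near_chart cx (open_nbhs_nbhs (conj U_open Ux)).
by apply: filterS => z [Uz cz cK]; rewrite /psi /= ph0.
Qed.

(** The flow equation gives the velocity in the chart at the point itself; the transition to [c]
    turns it into the field read in [c]. *)
Let psi_time_derive : \forall z \near c x,
  'D_((1 : R^o), (0 : E)) psi (0, z) = field_in_chart c X z.
Proof.
have [ph0 _ _ phX] := ph_flow.
have ez : `|0 : R| < eps by rewrite normr0.
have := near_chart cx (open_nbhs_nbhs (conj U_open Ux)).
apply: filterS => z [Uz cz cK]; rewrite derive_fst.
set w := cinv c z in Uz cz cK *.
have dw := chart_at_dom w; have da := chart_at_atlas w.
have := phX 0 w ez Uz; rewrite ph0 // => -[fd fE].
have {}fd : differentiable (fun s : R^o => chart_at w (ph s w)) (0 : R^o).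
  exact/derivable1_diffP.
have fw : chart_at w (ph 0 w) = chart_at w w by rewrite ph0.
have := @near_diff_comp _ _ _ _ _ (c \o cinv (chart_at w))
  (fun s : R^o => c (ph s w)) _ fd.
rewrite fw => -[||hd hE].
- exact: transition_differentiable.
- have : \forall q \near ph 0 w, cdom (chart_at w) q by rewrite ph0 //; exact: near_cdom.
  by move=> /(near_flow_time ez Uz); apply: filterS => s dq; rewrite /= cmapK.
by rewrite deriveE // hE -(deriveE _ fd) fE.
Qed.

(** The map [fun z => d' (ph t (cinv c z))] factors both through [psi] and through the chart at [x].
    Comparing the two differentials identifies the space derivative of [psi] with the image under
    [tangent_map (ph t)] of a vector of [xi x], which lies in [xi (ph t x)] by [ph_xi]. *)
Let flow_in_xi (t : R) (v : E) : flow_domain (t, c x) -> V (ph t x) ->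
  form_in_chart c eta (c x) v = 0 ->
  form_in_chart c eta (psi (t, c x)) ('D_((0 : R^o), v) psi (t, c x)) = 0.
Proof.
move=> dom Vt; rewrite /form_in_chart cmapK // => etav.
have [_ _ phs _] := ph_flow.
have [/= te _] := dom; rewrite cmapK // => ct.
have da := chart_at_atlas x; have dx := chart_at_dom x.
have d'a := chart_at_atlas (ph t x); have d'x := chart_at_dom (ph t x).
set d := chart_at x in da dx; set d' := chart_at (ph t x) in d'a d'x.
have phid := differentiable_snd (smooth_on_differentiable psi_smooth dom).
have psiE : psi (t, c x) = c (ph t x) by rewrite /psi /= cmapK.
have [||hd hE] := near_diff_comp (g := d' \o cinv c)
  (h := fun z => d' (ph t (cinv c z))) phid.
- by rewrite psiE; exact: transition_differentiable.
- by apply: filterS (near_flow_space te (near_cdom ct)) => z cz; rewrite /= /psi cmapK.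
have phd : differentiable (d' \o ph t \o cinv d) (d x).
  apply: (@differentiable_snd _ _ _ _ (fun ty : R^o * E => d' (ph ty.1 (cinv d ty.2))) t).
  apply: smooth_on_differentiable (phs d d' da d'a) _.
  by split; rewrite //= ?cmapK //; exists x.
have [||_ kE] := near_diff_comp (f := d \o cinv c) (g := d' \o ph t \o cinv d)
  (h := fun z => d' (ph t (cinv c z))) (transition_differentiable c_atlas da cx dx).
- by rewrite /= cmapK.
- apply: filterS (near_chart cx (near_cdom dx)) => z [dz _ _].
  by rewrite /= cmapK.
have vE : from_chart c (psi (t, c x)) ('D_((0 : R^o), v) psi (t, c x)) =
    tangent_map (ph t) x (from_chart c (c x) v).
  have -> : 'D_((0 : R^o), v) psi (t, c x) = 'd (fun z => psi (t, z)) (c x) v.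
    by rewrite derive_snd; exact: deriveE.
  have cpsi : cinv c (psi (t, c x)) = ph t x by rewrite psiE cmapK.
  have -> w : from_chart c (psi (t, c x)) w = 'd (d' \o cinv c) (psi (t, c x)) w.
    by rewrite /from_chart cpsi; reflexivity.
  have -> : from_chart c (c x) v = 'd (d \o cinv c) (c x) v.
    by rewrite /from_chart (cmapK cx); reflexivity.
  apply: (eq_trans (esym (hE v))); apply: (eq_trans (kE v)).
  have -> : (d \o cinv c) (c x) = d x by rewrite /= cmapK.
  reflexivity.
rewrite vE psiE cmapK //; apply/(eta_form.2 _ Vt).
have : [set` xi (ph t x)] (tangent_map (ph t) x (from_chart c (c x) v)).
  rewrite -ph_xi //.
  by exists (from_chart c (c x) v) => //; apply/(eta_form.2 _ Vx).
by [].
Qed.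

(** For all small times the form at [psi (t, c x)] kills the vector transported from [v], by
    [flow_in_xi]; the Leibniz rule at time 0 gives the two terms. *)
Lemma contact_flow_lie (v : E) : smooth_field V X ->
  form_in_chart c eta (c x) v = 0 ->
  'D_(field_in_chart c X (c x)) (fun y => form_in_chart c eta y v) (c x) +
    form_in_chart c eta (c x) ('D_v (field_in_chart c X) (c x)) = 0.
Proof.
move=> Xs etav.
have psi0x : psi (0, c x) = c x := nbhs_singleton psi0.
have [[al als] _] := eta_form.
have ndom : nbhs ((0, c x) : R^o * E) flow_domain.
  by apply: filterS near_flow_domain => ty [].
have dom0 := nbhs_singleton ndom.
have psid := smooth_on_differentiable psi_smooth dom0.
have psidd := smooth_on_differentiable
  (smooth_on_derive ((0 : R^o), v) psi_smooth) dom0.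
have formd w : differentiable (fun y => form_in_chart c eta y w : R^o) (c x).
  by apply: smooth_on_differentiable (als c c_atlas w) _; exists x.
have psiv : 'D_((0 : R^o), v) psi (0, c x) = v.
  by rewrite derive_snd (near_eq_derive _ psi0) derive_id.
(* By symmetry of mixed derivatives, the time derivative of the transported vector is the space
   derivative of the velocity field. *)
have mixed : 'D_((1 : R^o), (0 : E)) ('D_((0 : R^o), v) psi) (0, c x) =
    'D_v (field_in_chart c X) (c x).
  by rewrite (derive_schwarz_rV _ _ ndom psi_smooth) derive_snd (near_eq_derive _ psi_time_derive).
have [|||_ /(_ ((1 : R^o), (0 : E)))] :=
  @derive_pairing R _ _ (fun ty => form_in_chart c eta (psi ty))
    ('D_((0 : R^o), v) psi) (0, c x).
- apply: filterS near_flow_domain => ty [[_ _ cty] Vty].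
  by apply: form_in_chart_linear; rewrite /psi cmapK //; exact: al.
- move=> w; apply: (@differentiable_comp _ _ _ _ psi
    (fun y => form_in_chart c eta y w : R^o)) => //.
  by rewrite psi0x.
- exact: psidd.
rewrite derive_fst mixed psiv psi0x.
have -> : 'D_((1 : R^o), (0 : E)) (fun ty => form_in_chart c eta (psi ty) v) (0, c x) =
   'D_(field_in_chart c X (c x)) (fun y => form_in_chart c eta y v) (c x).
  have [||hd hE] := near_diff_comp (g := fun y => form_in_chart c eta y v : R^o)
    (h := fun ty => form_in_chart c eta (psi ty) v : R^o) psid.
  - by rewrite psi0x.
  - by apply: filterS near_flow_domain => ty _; reflexivity.
  rewrite (deriveE _ hd) hE psi0x -(deriveE _ psid).
  rewrite (nbhs_singleton psi_time_derive); exact: esym (deriveE _ (formd v)).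
move=> <-; rewrite -[RHS](derive_cst (0 : R) (0 : R) 1).
apply: near_eq_derive.
have := near_pair_fst near_flow_domain; apply: filterS => s [doms Vs].
by apply: flow_in_xi; rewrite //; move: Vs; rewrite /= cmapK.
Qed.

End ContactFlow.

(** * Transfer of the coordinate argument to the manifold *)

Theorem proposition2p2 (R : realType) (n : nat) (M : smoothManifold R (n * 2))
    (xi : M -> {vspace 'rV[R]_(n * 2).+1}) (xi_contact : contact_structure xi)
    (V : set M) (V_open : open V)
    (eta : M -> 'rV[R]_(n * 2).+1 -> R) (eta_form : contact_form xi V eta)
    (Reeb : M -> 'rV[R]_(n * 2).+1) (Reeb_field : reeb_field V eta Reeb)
    (X : M -> 'rV[R]_(n * 2).+1) (X_contact : contact_field xi X)
    (x0 : M) (V_x0 : V x0) (X_x0 : equilibrium X x0) :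
  let H := hamiltonian eta X in
  let tau := principal_coefficient H Reeb x0 in
  tau != 0 ->
  nondegenerate_form_on (xi x0)
    (Dform (fun x v => dfun H x v + tau * eta x v) x0) ->
  nondegenerate_equilibrium X x0.
Proof.
move=> H tau tau0 nondeg.
set c := chart_at x0.
have ca : atlas c := chart_at_atlas x0; have cx : cdom c x0 := chart_at_dom x0.
pose O := c @` (cdom c `&` V).
pose a := form_in_chart c eta; pose Y := field_in_chart c X.
have [[al als] eta_ker] := eta_form.
have [Xs Xflow] := X_contact.
have XsV : smooth_field V X.
  move=> d da; apply: smooth_on_subset (Xs d da).
  by apply: image_subset => x [].
have Oo : open O by exact: open_chart_image.
have Oc : O (c x0) by exists x0.
have a_lin y : O y -> linear (a y : 'rV[R]_(n * 2).+1 -> R^o).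
  by move=> [x [cdx Vx] <-]; apply: form_in_chart_linear; rewrite cmapK //; exact: al.
have Yc : Y (c x0) = 0.
  by rewrite /Y /field_in_chart cmapK // X_x0 /to_chart linear0.
have ac v : a (c x0) v = eta x0 v.
  by rewrite /a /form_in_chart from_chart_at cmapK.
have ar : a (c x0) (Reeb x0) = 1 by rewrite ac; have [] := Reeb_field.2 x0 V_x0.
(* The local flow is taken around each point of [V] in the chart domain while the chart stays the
   one at [x0]; the identity thus holds on all of [O] and can be differentiated. *)
have lie_ker y v : O y -> a y v = 0 ->
    'D_(Y y) (fun z => a z v) y + a y ('D_v Y y) = 0.
  move=> [x [cdx Vx] <-] av.
  have [eps [U [ph [e0 Uo Ux phf phxi]]]] := Xflow x.
  exact: (contact_flow_lie V_open eta_form e0 Uo phf phxi ca cdx Ux Vx XsV av).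
have HE : \forall y \near c x0, - a y (Y y) = H (cinv c y).
  apply: filterS (near_chart cx (near_cdom cx)) => y [_ cy cK].
  by rewrite /a /Y -{1 2}cK form_in_chart_field.
have Hd d x : atlas d -> cdom d x -> V x ->
    differentiable (H \o cinv d : _ -> R^o) (d x).
  by move=> da dx Vx; apply: differentiableN; exact: (smooth_form_field_differentiable da V_open dx Vx eta_form.1 XsV).
have tauE : tau = - 'D_(Reeb x0) (fun y => - a y (Y y)) (c x0).
  rewrite (near_eq_derive _ HE) /tau /principal_coefficient /dfun -/c deriveE //.
  exact: Hd.
(* The linear part acts on row vectors, so an eigenvector [u] for 0 satisfies ['D_u Y (c x0) = 0];
   it remains to show [u = 0]. *)
apply/negP => /eigenvalueP[u]; rewrite scale0r => Au /negP; apply; apply/eqP.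
have Yu : 'D_u Y (c x0) = 0.
  rewrite deriveEjacobian //.
  exact: smooth_on_differentiable (XsV c ca) Oc.
apply: (linearized_kernel_trivial Oo a_lin (als c ca) (XsV c ca) lie_ker Oc Yc ar) Yu.
  by rewrite -tauE.
rewrite -tauE => w aw wv; apply: nondeg; first by apply/(eta_ker _ V_x0); rewrite -ac.
move=> v /(eta_ker _ V_x0) etav.
rewrite /Dform -/c -[RHS](wv v) ?ac //.
apply: near_eq_derive.
have := near_chart cx (open_nbhs_nbhs (conj V_open V_x0)).
(* The Hamiltonian is differentiated at each [y] near [c x0], so its coordinate expression is needed
   on a neighbourhood of every such [y]. *)
have := near_join HE.
apply: filterS2 => y HEy [Vy cy cK].
rewrite (near_eq_derive _ HEy) -{2}cK.
rewrite -(form_in_chart_dfun v ca cy); last first.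
  by apply: Hd => //; [exact: chart_at_atlas|exact: chart_at_dom].
by rewrite cK.
Qed.
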